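(* Let $V$ be a finite vertex set, let $H_1,\dots,H_N$ ($N\ge 1$) be unweighted, undirected graphs on $V$, and let $c$ be a target clustering of $V$, i.e. a function assigning to each vertex its cluster. Suppose the LBGA process (defined in the context) is run on $H_1,\dots,H_N$ with the oracle quality function $q_c$, where $q_c(u,v)=1$ if $c(u)=c(v)$ and $q_c(u,v)=-1$ if $c(u)\ne c(v)$, with a null event $A$, and with learning parameters satisfying $0<\varepsilon=\nu<1/2$. Suppose further that for every vertex pair $(u,v)$, $u\neq v$, some input graph $H_i$ is good for $(u,v)$. Then for any $0<\delta<1$ and for all vertex pairs $(u,v)$, after $O(\log(1/\delta))$ rounds the probability $p_{u,v,\mathrm{bad}}$ satisfies $p_{u,v,\mathrm{bad}}<\delta$. Explicitly: there is a constant $C>0$, depending only on $N$ and $\varepsilon$, such that for every $\delta\in(0,1)$, every vertex pair $(u,v)$ with $u\ne v$, and every integer $t\ge C\log(1/\delta)$, one has $p^{t}_{u,v,\mathrm{bad}}<\delta$, where $p^{t}_{u,v,\mathrm{bad}}$ denotes the value of $p_{u,v,\mathrm{bad}}$ after $t$ rounds.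
   Context: Good and bad graphs: an input graph $H_i$ is called good for a vertex pair $(u,v)$ if it agrees with $c$ on that pair, i.e. either $(u,v)$ is an edge of $H_i$ and $c(u)=c(v)$, or $(u,v)$ is not an edge of $H_i$ and $c(u)\neq c(v)$. Otherwise $H_i$ is called bad for $(u,v)$. LBGA (Locally Boosted Graph Aggregation): for each vertex pair $(u,v)$ with $u\ne v$ and each input graph $H_i$ the process maintains a weight $w_{u,v,i}$, initialized to $1$. In each round $t$ a candidate graph $G_t$ is formed as follows: for each pair $(u,v)$ an index $i$ is sampled with probability proportional to $w_{u,v,i}$, and $(u,v)$ is included in $G_t$ if and only if it is an edge of the sampled $H_i$. In general an event $A(G_t)$ (for example, a clustering of $G_t$) is then computed, and each pair $(u,v)$ receives a quality value $q_{u,v}$, which may depend on $G_t$ and $A(G_t)$. ''Null event'' means that no such $A$ is used; here the quality value is simply $q_{u,v}=q_c(u,v)$ in every round. At the end of each round, for every vertex pair $(u,v)$ and every $i$, the weights are updated by the rule $$w_{u,v,i}\leftarrow\begin{cases} w_{u,v,i}\,(1+\varepsilon\, q_{u,v}) & \text{if } (u,v) \text{ is an edge of } H_i,\\ w_{u,v,i}\,(1-\nu\, q_{u,v}) & \text{if } (u,v)\text{ is not an edge of } H_i,\end{cases}$$ where $\varepsilon,\nu>0$ are the learning rate parameters. Notation: for a vertex pair $(u,v)$, let $w_{u,v,\mathrm{good}}=\sum_{H_i \text{ good for }(u,v)} w_{u,v,i}$ and $w_{u,v,\mathrm{bad}}=\sum_{H_i\text{ bad for }(u,v)} w_{u,v,i}$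 (empty sums are $0$). Then $p_{u,v,\mathrm{bad}}=\dfrac{w_{u,v,\mathrm{bad}}}{w_{u,v,\mathrm{good}}+w_{u,v,\mathrm{bad}}}$ is the probability of picking a bad input graph for $(u,v)$ when sampling proportionally to the weights. *)

(* Defs.v *)
From HB Require Import structures.
From mathcomp Require Import all_boot all_order all_algebra.
From mathcomp Require Import all_classical all_reals all_analysis.

Set Implicit Arguments.
Unset Strict Implicit.
Unset Printing Implicit Defensive.

Import Order.TTheory GRing.Theory Num.Theory.

Local Open Scope classical_set_scope.
Local Open Scope ring_scope.

Section LBGA.

Context {R : realType} {V : finType} {N : nat}.

(* An undirected graph on V is a symmetric [rel V]. Only pairs u != v are ever
   consulted, so loops, and the entries of the functions below on the diagonal,
   are irrelevant. *)
Implicit Types (H : 'I_N -> rel V) (u v : V) (i : 'I_N).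

Definition weights : Type := V -> V -> 'I_N -> R.

(* The indices drawn in one round, one for each vertex pair; [lbga_process]
   below forces (u, v) and (v, u), which are the same pair, to share a draw. *)
Definition draws : Type := {ffun V * V -> 'I_N}.

Definition pick_prob (w : weights) u v i : R :=
  w u v i / \sum_(j < N) w u v j.

Definition candidate H (s : draws) : rel V :=
  fun u v => (u != v) && H (s (u, v)) u v.

Definition update (eps nu : R) H (q : V -> V -> R) (w : weights) : weights :=
  fun u v i => if H i u v then w u v i * (1 + eps * q u v)
               else w u v i * (1 - nu * q u v).

(* [A] is the event computed from the candidate graph, with values in an
   arbitrary type X, and [Q G a u v] is the quality value of the pair (u, v)
   when the candidate graph is G and the event is a. [lbga_weights .. s t] are
   the weights after t rounds when the draws of round r (counted from 0) are
   [s r]. *)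
Fixpoint lbga_weights {X : Type} (eps nu : R) H (A : rel V -> X)
    (Q : rel V -> X -> V -> V -> R) (s : nat -> draws) (t : nat) : weights :=
  if t is t'.+1 then
    let G := candidate H (s t') in
    update eps nu H (Q G (A G)) (lbga_weights eps nu H A Q s t')
  else fun _ _ _ => 1.

(* [S t] are the random draws of round t. Conditionally on the draws of the
   earlier rounds, each pair draws i with probability proportional to its
   current weight; the joint law of the draws of distinct pairs within a round
   is left unconstrained (independent draws being one possibility). *)
Definition lbga_process {X : Type} {d : measure_display}
    {Omega : measurableType d} (P : probability Omega R) (eps nu : R) H
    (A : rel V -> X) (Q : rel V -> X -> V -> V -> R)
    (S : nat -> Omega -> draws) : Prop :=
  [/\ forall t s, measurable [set omega | S t omega = s],
      forall t omega u v, S t omega (u, v) = S t omega (v, u)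
    & forall t (h : nat -> draws) u v i, u != v ->
        let past := [set omega | forall r, (r < t)%N -> S r omega = h r] in
        P (past `&` [set omega | S t omega (u, v) = i]) =
        (P past * (pick_prob (lbga_weights eps nu H A Q h t) u v i)%:E)%E].

Definition null_event : rel V -> unit := fun _ => tt.

Section Clustering.

Context {K : eqType}.
Implicit Type c : V -> K.

Definition good H c u v i : bool :=
  (H i u v && (c u == c v)) || (~~ H i u v && (c u != c v)).

Definition bad H c u v i : bool := ~~ good H c u v i.

Definition oracle c u v : R := if c u == c v then 1 else -1.

Definition oracle_quality c : rel V -> unit -> V -> V -> R :=
  fun _ _ => oracle c.

Definition w_good H c (w : weights) u v : R :=
  \sum_(i < N | good H c u v i) w u v i.

Definition w_bad H c (w : weights) u v : R :=
  \sum_(i < N | bad H c u v i) w u v i.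

Definition p_bad H c (w : weights) u v : R :=
  w_bad H c w u v / (w_good H c w u v + w_bad H c w u v).

End Clustering.

End LBGA.

(* Main.v *)
(* With the oracle quality, a weight is multiplied in every round by 1 + eps if
   its graph is good for the pair and by 1 - eps if it is bad, whatever was
   drawn. Hence, with g >= 1 good and b > 0 bad graphs and sigma = (1 + eps)/(1 - eps),
   1 / p_bad = 1 + (g / b) sigma^t > 1 + (sigma^t - 1) / N, and by convexity
   this is at least y^t, where y = 1 + (sigma - 1) / N. So C = 1 / ln y works,
   even for delta close to 1. *)
Require Import Defs.
From HB Require Import structures.
From mathcomp Require Import all_boot all_order all_algebra.
From mathcomp Require Import all_classical all_reals all_analysis.
From mathcomp Require Import ring lra.

Set Implicit Arguments.
Unset Strict Implicit.
Unset Printing Implicit Defensive.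

Import Order.TTheory GRing.Theory Num.Theory.

Local Open Scope ring_scope.

(** The sign of [oracle] turns the edge factor into [1 + eps] and the non-edge factor into [1 - eps]
    when [u] and [v] share a cluster, and swaps the two otherwise. A single closed form results
    because both rates equal [eps]. *)
Lemma oracle_weights (R : realType) (V : finType) (N : nat) (K : eqType)
    (H : 'I_N -> rel V) (c : V -> K) (eps : R)
    (s : nat -> {ffun V * V -> 'I_N}) (t : nat) (u v : V) (i : 'I_N) :
  lbga_weights eps eps H null_event (oracle_quality c) s t u v i =
  (if good H c u v i then 1 + eps else 1 - eps) ^+ t.
Proof.
elim: t => [|t IHt]; first by rewrite expr0.
rewrite /= /update IHt exprSr /good /oracle_quality /oracle.
by case: (H i u v); case: (c u == c v);
  rewrite /= ?mulr1 ?mulrN1 ?opprK.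
Qed.

(* Convexity of s |-> s^t between 1 and sigma. *)
Lemma expr_convex1 (R : realDomainType) (x sigma : R) (t : nat) :
  0 <= x <= 1 -> 1 <= sigma ->
  (1 + x * (sigma - 1)) ^+ t <= 1 + x * (sigma ^+ t - 1).
Proof.
move=> /andP[x0 x1] sigma1; elim: t => [|t IHt].
  by rewrite !expr0 subrr mulr0 addr0.
have st1 : 1 <= sigma ^+ t by rewrite exprn_ege1.
have y0 : 0 <= 1 + x * (sigma - 1) by rewrite addr_ge0 ?mulr_ge0 ?subr_ge0.
rewrite !exprS; apply: (le_trans (ler_wpM2l y0 IHt)); rewrite -subr_ge0.
(* The gap is the covariance of two variables, equal to 1 with probability [1 - x] and to [sigma],
   resp. [sigma ^+ t], with probability [x]. *)
have -> : 1 + x * (sigma * sigma ^+ t - 1) -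
    (1 + x * (sigma - 1)) * (1 + x * (sigma ^+ t - 1)) =
    x * (1 - x) * ((sigma - 1) * (sigma ^+ t - 1)) by ring.
by rewrite !mulr_ge0 ?subr_ge0.
Qed.

Theorem theorem1 (R : realType) (N : nat) (eps nu : R) :
  (1 <= N)%N -> 0 < eps -> eps = nu -> nu < 1 / 2 ->
  exists C : R, 0 < C /\
    forall (V : finType) (K : eqType) (H : 'I_N -> rel V) (c : V -> K),
      (forall i : 'I_N, symmetric (H i)) ->
      (forall u v : V, u != v -> exists i : 'I_N, good H c u v i) ->
    forall (d : measure_display) (Omega : measurableType d)
           (P : probability Omega R)
           (S : nat -> Omega -> {ffun V * V -> 'I_N}),
      lbga_process P eps nu H null_event (oracle_quality c) S ->
    forall delta : R, 0 < delta < 1 ->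
    forall u v : V, u != v ->
    forall t : nat, C * ln (1 / delta) <= t%:R ->
    forall omega : Omega,
      p_bad H c
        (lbga_weights eps nu H null_event (oracle_quality c)
           (fun r => S r omega) t) u v < delta.
Proof.
move=> N1 eps0 <- eps2.
have a0 : 0 < 1 - eps by lra.
have A0 : 0 < 1 + eps by lra.
have N0 : 0 < N%:R :> R by rewrite ltr0n.
pose sigma := (1 + eps) / (1 - eps).
have sigma1 : 1 < sigma by rewrite ltr_pdivlMr //; lra.
pose y := 1 + N%:R^-1 * (sigma - 1).
have y1 : 1 < y by rewrite ltrDl mulr_gt0 ?invr_gt0 // subr_gt0.
have lny0 : 0 < ln y by rewrite ln_gt0.
exists (ln y)^-1; split; first by rewrite invr_gt0.
move=> V K H c _ Hgood d Omega P S _ delta /andP[delta0 _] u v uv t.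
rewrite ler_pdivrMl // => ht omega.
(* This is the bound on [t], exponentiated. *)
have yt : 1 <= delta * y ^+ t.
  rewrite -ler_pdivrMl // mulr1 -div1r -ler_ln ?posrE ?divr_gt0 //;
    last by rewrite exprn_gt0 // (lt_trans _ y1).
  by rewrite lnXn ?(lt_trans _ y1) // -mulr_natr.
have {Hgood} g1 : (0 < #|[pred i | good H c u v i]|)%N.
  by have [i gi] := Hgood u v uv; apply/card_gt0P; exists i.
have bN : (#|[pred i | bad H c u v i]| <= N)%N.
  by rewrite -[leqRHS]card_ord max_card.
set g := #|_| in g1; set b := #|_| in bN.
rewrite /p_bad.
have -> : w_good H c (lbga_weights eps eps H null_event (oracle_quality c)
    (fun r => S r omega) t) u v = g%:R * (1 + eps) ^+ t.
  rewrite /w_good (eq_bigr (fun=> (1 + eps) ^+ t)) => [|i gi].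
    by rewrite sumr_const mulr_natl.
  by rewrite oracle_weights gi.
have -> : w_bad H c (lbga_weights eps eps H null_event (oracle_quality c)
    (fun r => S r omega) t) u v = b%:R * (1 - eps) ^+ t.
  rewrite /w_bad (eq_bigr (fun=> (1 - eps) ^+ t)) => [|i /negbTE bi].
    by rewrite sumr_const mulr_natl.
  by rewrite oracle_weights bi.
have at0 : 0 < (1 - eps) ^+ t by rewrite exprn_gt0.
have At0 : 0 < (1 + eps) ^+ t by rewrite exprn_gt0.
have gR : 1 <= g%:R :> R by rewrite ler1n.
have bR : b%:R / N%:R <= 1 :> R by rewrite ler_pdivrMr // mul1r ler_nat.
have B0 : 0 <= b%:R * (1 - eps) ^+ t by rewrite mulr_ge0 ?ler0n // ltW.
have G1 : (1 + eps) ^+ t <= g%:R * (1 + eps) ^+ t by rewrite ler_peMl // ltW.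
(* The bound [y ^+ t < 1 / p_bad] with denominators cleared, so that [b = 0] needs no separate
   case. *)
have By : b%:R * (1 - eps) ^+ t * y ^+ t <
    g%:R * (1 + eps) ^+ t + b%:R * (1 - eps) ^+ t.
  have xN : 0 <= (N%:R^-1 : R) <= 1.
    by rewrite invr_ge0 ltW //= invf_le1 // ler1n.
  have := ler_wpM2l B0 (expr_convex1 t xN (ltW sigma1)).
  move=> /le_lt_trans; apply.
  have -> : b%:R * (1 - eps) ^+ t * (1 + N%:R^-1 * (sigma ^+ t - 1)) =
      b%:R * (1 - eps) ^+ t +
      b%:R / N%:R * ((1 + eps) ^+ t - (1 - eps) ^+ t).
    by rewrite /sigma expr_div_n; field; rewrite !gt_eqF.
  have aA : 0 <= (1 + eps) ^+ t - (1 - eps) ^+ t.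
    by rewrite subr_ge0 lerXn2r ?nnegrE ?ltW //; lra.
  (* Strictness comes from [at0]: the excess is at most [(1 + eps) ^+ t - (1 - eps) ^+ t], which is
     less than [(1 + eps) ^+ t]. *)
  have := ler_wpM2r aA bR; lra.
rewrite ltr_pdivrMr; last by lra.
(* The first comparison, by [yt], may be an equality; the strict one is [By] scaled by [delta]. *)
apply: (@le_lt_trans _ _ (delta * y ^+ t * (b%:R * (1 - eps) ^+ t))).
  by rewrite ler_peMl.
by rewrite -mulrA ltr_pM2l // mulrC.
Qed.
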